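(* Let $f\colon[0,\infty)\times\mathbb{N}_0\to[0,\infty)$ satisfy the contractive condition: there are constants $\kappa_1,\kappa_2\ge 0$ with $\kappa:=\kappa_1+\kappa_2<1$ such that $$|f(\lambda,y)-f(\lambda',y')|\le \kappa_1|\lambda-\lambda'|+\kappa_2|y-y'|\qquad\text{for all }\lambda,\lambda'\ge0,\ y,y'\in\mathbb{N}_0.$$ Consider the bivariate Markov chain $((N_t,\lambda_t))_{t\in\mathbb{N}}$ defined by: $\lambda_1\ge0$ is a (random or deterministic) starting value, $N_t\mid\mathcal{B}^{N,\lambda}_{t-1}\sim\mathrm{Poisson}(\lambda_t)$ and $\lambda_t=f(\lambda_{t-1},N_{t-1})$, where $\mathcal{B}^{N,\lambda}_t=\sigma(\lambda_1,\dots,\lambda_t,N_1,\dots,N_t)$. Then: (i) the chain has a unique stationary distribution $\pi$ (a probability measure on $\mathbb{N}_0\times[0,\infty)$); (ii) if $(N_1,\lambda_1)\sim\pi$, then $E\lambda_1<\infty$; (iii) if $f(0,0)=0$, then $\pi$ is the point mass at $(0,0)$; if $f(0,0)>0$, then $\pi(\{(y,\lambda)\})<1$ for every $y\in\mathbb{N}_0$, $\lambda\in[0,\infty)$, i.e. $\pi$ is not a point mass.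
   Context: $\mathbb{N}_0=\{0,1,2,\dots\}$. $\mathrm{Poisson}(0)$ denotes the point mass at $0$. The transition mechanism defines a time-homogeneous Markov chain on $\mathbb{N}_0\times[0,\infty)$. *)

(* Defs.v *)
From mathcomp Require Import all_boot all_order all_algebra.
From mathcomp Require Import all_classical all_reals all_analysis.
Set Implicit Arguments. Unset Strict Implicit. Unset Printing Implicit Defensive.
Import Order.TTheory GRing.Theory Num.Theory.
Local Open Scope classical_set_scope.
Local Open Scope ring_scope.

(* The map f : [0,oo) x N0 -> [0,oo) is represented as f : R -> nat -> R,
   written f lambda y; only its values for lambda >= 0 matter. *)

Definition contractive (R : realType) (f : R -> nat -> R) : Prop :=
  (forall l y, 0 <= l -> 0 <= f l y) /\
  exists k1 k2 : R, [/\ 0 <= k1, 0 <= k2, k1 + k2 < 1 &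
    forall l l' (y y' : nat), 0 <= l -> 0 <= l' ->
      `|f l y - f l' y'| <= k1 * `|l - l'| + k2 * `|y%:R - y'%:R|].

Definition state_space (R : realType) : set (nat * R) :=
  [set x | 0 <= x.2].

(* Transition kernel of the chain (N_t, lambda_t): from state (y, l),
   lambda' = f l y deterministically and N' ~ Poisson(lambda')
   (Poisson(0) = point mass at 0, as in poisson_prob). *)
Definition trans_kernel (R : realType) (f : R -> nat -> R)
    (x : nat * R) (A : set (nat * R)) : \bar R :=
  poisson_prob (f x.2 x.1) 0%N [set k | A (k, f x.2 x.1)].

Definition stationary (R : realType) (f : R -> nat -> R)
    (P : probability (nat * R)%type R) : Prop :=
  P (@state_space R) = 1%E /\
  forall A : set (nat * R), measurable A ->
    P A = (\int[P]_(x in @state_space R) trans_kernel f x A)%E.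

(* Main.v *)
(* Write s' = f (s, N) with N ~ Poisson(s) for the chain of intensities, and K
   for its Markov operator. The derivative in s of E h(N) is E[h(N+1) - h(N)],
   so N contributes a Lipschitz factor 1 and K shrinks Lipschitz constants by
   k1 + k2 < 1. Since Poisson(0) is a point mass, (K g)(0) = g (f 0 0), whence
   |K^(n+1) g (0) - K^n g (0)| is at most Lip(g) (k1 + k2)^n f(0,0): the limit
   L g of K^n g exists, does not depend on the starting point, and is the only
   possible integral of g against a stationary intensity law. Existence: L is a
   positive normalized functional, a distribution function is read off its
   values on ramps, and its Lebesgue-Stieltjes measure represents L. A law P of
   (N, lambda) is stationary iff it is obtained by attaching a Poisson(lambda)
   coordinate to the law of f(lambda, N) under P. *)
From HB Require Import structures.
Require Import Defs.
From mathcomp Require Import all_boot all_order all_algebra.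
From mathcomp Require Import all_classical all_reals all_analysis.
From mathcomp Require Import measurable_realfun giry ring lra.
Set Implicit Arguments. Unset Strict Implicit. Unset Printing Implicit Defensive.
Import Order.TTheory GRing.Theory Num.Theory.
Import numFieldNormedType.Exports.
Local Open Scope classical_set_scope.
Local Open Scope ring_scope.

(** * Poisson means of bounded functions *)

Section PoissonAverage.
Context {R : realType}.
Implicit Types (h : nat -> R) (s t : R).

Definition bounded_by {T : Type} (M : R) (h : T -> R) := forall k, `|h k| <= M.

Definition poisson_coef h k : R := h k / k`!%:R.

(** The expectation of [h N] for N Poisson with parameter [s], written as a power series in [s] so
    that it can be differentiated termwise. *)
Definition poisson_mean h s : R :=
  expR (- s) * limn (pseries (poisson_coef h) s).

Lemma cvg_poisson_coef h M s :
  bounded_by M h -> cvgn (pseries (poisson_coef h) s).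
Proof.
move=> hM; have M0 : 0 <= M by exact: le_trans (hM 0%N).
apply: normed_cvg.
apply: (@series_le_cvg _ _ (fun k => M * exp_coeff `|s| k)) => [||k|].
- by move=> k /=.
- by move=> k; rewrite /= mulr_ge0// exp_coeff_ge0.
- rewrite /poisson_coef /exp_coeff /= mulrAC !normrM normrX normfV.
  rewrite [`|k`!%:R|]ger0_norm//.
  by rewrite -mulrA ler_wpM2r// mulr_ge0 ?exprn_ge0 ?invr_ge0.
- exact/is_cvg_seriesZ/is_cvg_series_exp_coeff.
Qed.

Lemma poisson_mean_cst (c : R) s : poisson_mean (cst c) s = c.
Proof.
rewrite /poisson_mean.
have -> : pseries (poisson_coef (cst c)) s = series (c *: exp_coeff s).
  congr series; apply/funext => k; rewrite /poisson_coef /exp_coeff /=.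
  by rewrite fctE -mulrA [_^-1 * _]mulrC.
rewrite lim_seriesZ; last exact: is_cvg_series_exp_coeff.
by rewrite mulrCA -[limn _]/(expR s) -expRD addNr expR0; apply: mulr1.
Qed.

Lemma poisson_meanD h h' M M' s : bounded_by M h -> bounded_by M' h' ->
  poisson_mean (fun k => h k + h' k) s = poisson_mean h s + poisson_mean h' s.
Proof.
move=> hM hM'; rewrite /poisson_mean -mulrDr; congr (_ * _).
rewrite -lim_seriesD; [|exact: cvg_poisson_coef hM|exact: cvg_poisson_coef hM'].
congr (limn (series _)); apply/funext => k.
by rewrite /poisson_coef /= !mulrDl.
Qed.

Lemma poisson_meanZ h M s (c : R) : bounded_by M h ->
  poisson_mean (fun k => c * h k) s = c * poisson_mean h s.
Proof.
move=> hM; rewrite /poisson_mean mulrCA; congr (_ * _).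
have -> : pseries (poisson_coef (fun k => c * h k)) s =
    series (c *: [sequence poisson_coef h k * s ^+ k]_k).
  apply/funext => n; apply: eq_bigr => k _.
  by rewrite [RHS](_ : _ = c * (poisson_coef h k * s ^+ k))// !mulrA.
by apply: lim_seriesZ; exact: cvg_poisson_coef hM.
Qed.

Lemma le_poisson_mean h h' M M' s : bounded_by M h -> bounded_by M' h' ->
  0 <= s -> (forall k, h k <= h' k) -> poisson_mean h s <= poisson_mean h' s.
Proof.
move=> hM hM' s0 hh'; rewrite /poisson_mean ler_wpM2l ?expR_ge0//.
apply: lim_series_le; [exact: cvg_poisson_coef hM|exact: cvg_poisson_coef hM'|].
by move=> k; rewrite ler_wpM2r ?exprn_ge0// ler_wpM2r ?invr_ge0.
Qed.

Lemma poisson_mean_bounded h M s : bounded_by M h -> 0 <= s ->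
  `|poisson_mean h s| <= M.
Proof.
move=> hM s0; have M0 : 0 <= M by exact: le_trans (hM 0%N).
have cM (c : R) : `|c| <= M -> bounded_by M (cst c : nat -> R) by move=> ? k.
have MM : `|M| <= M by rewrite ger0_norm.
have NM : `|- M| <= M by rewrite normrN.
rewrite ler_norml; apply/andP; split.
  rewrite -[leLHS](poisson_mean_cst _ s); apply: (le_poisson_mean (cM _ NM) hM s0).
  by move=> k; have := hM k; rewrite ler_norml => /andP[].
rewrite -[leRHS](poisson_mean_cst _ s); apply: (le_poisson_mean hM (cM _ MM) s0).
by move=> k; have := hM k; rewrite ler_norml => /andP[].
Qed.

Lemma poisson_mean0 h : poisson_mean h 0 = h 0%N.
Proof.
rewrite /poisson_mean oppr0 expR0 mul1r; apply: cvg_lim => //.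
apply/cvg_ballP => e e0; near=> n.
rewrite /pseries /series /= -(prednK (_ : 0 < n)%N); last by near: n; exists 1%N.
rewrite big_nat_recl//= big1 ?addr0; last by move=> i _; rewrite expr0n mulr0.
by rewrite /poisson_coef expr0 fact0 divr1 mulr1; exact: ballxx.
Unshelve. all: by end_near. Qed.

Lemma is_derive_poisson_mean h M s : bounded_by M h ->
  is_derive s (1 : R) (poisson_mean h)
    (poisson_mean (fun k => h k.+1 + (-1) * h k) s).
Proof.
move=> hM.
(* Formal differentiation shifts [g] by one, since (k + 1) / (k + 1)! = 1 / k!. *)
have diffs g : pseries_diffs (poisson_coef g) = poisson_coef (fun k => g k.+1).
  apply/funext => k; rewrite /pseries_diffs /poisson_coef factS natrM invfM.
  by rewrite mulrCA mulVKf.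
have hMS : bounded_by M (fun k => h k.+1) by move=> k.
have hN : bounded_by M (fun k => - 1 * h k) by move=> k; rewrite mulN1r normrN.
(* Termwise differentiation asks the series and its first two formal derivatives to converge at a
   point beyond [s], here |s| + 1; shifts of [h] keep the bound [M]. *)
have dE := @pseries_snd_diffs R (poisson_coef h) (`|s| + 1) s.
rewrite !diffs in dE.
have {}dE := dE (cvg_poisson_coef hM) (cvg_poisson_coef hMS)
  (cvg_poisson_coef (fun k => hM k.+2)).
have {}dE : is_derive s (1 : R) (fun x => limn (pseries (poisson_coef h) x))
    (limn (pseries (poisson_coef (fun k => h k.+1)) s)).
  by apply: dE; rewrite [ltRHS]ger0_norm ?addr_ge0// ltrDl.
have dexp : is_derive s (1 : R) (fun x : R => expR (- x)) (- expR (- s)).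
  by apply: is_derive_eq; rewrite ?mulrN1 ?scaler1 //.
rewrite (_ : poisson_mean h = (fun x : R => expR (- x)) *
   (fun x => limn (pseries (poisson_coef h) x)))//.
apply: (is_derive_eq (is_deriveM dexp dE)).
rewrite (poisson_meanD _ hMS hN) (poisson_meanZ _ _ hM).
rewrite /poisson_mean /=.
by rewrite mulN1r -mulNr mulrC [in RHS]mulrC /GRing.scale/= mulrC [in LHS](mulrC _ (- _)).
Qed.

(** Mean value theorem: the derivative is a Poisson mean of increments of [h], taken at a
    nonnegative intermediate point, so [A] bounds it. *)
Lemma poisson_mean_lipschitz h M A s t : bounded_by M h ->
  (forall k, `|h k.+1 - h k| <= A) -> 0 <= s -> 0 <= t ->
  `|poisson_mean h s - poisson_mean h t| <= A * `|s - t|.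
Proof.
move=> hM hA; wlog st : s t / t <= s => [wl s0 t0|s0 t0].
  have [ts|/ltW st] := leP t s; first exact: wl.
  by rewrite distrC [`|s - t|]distrC; exact: wl.
have dE x := is_derive_poisson_mean x hM.
have [c cst_ ->] := MVT_segment st (fun x _ => dE x)
  (derivable_within_continuous (fun x _ => @ex_derive _ _ _ _ _ _ _ (dE x))).
rewrite normrM ler_wpM2r//; apply: poisson_mean_bounded.
  by move=> k; rewrite mulN1r.
by move: cst_; rewrite in_itv/= => /andP[+ _]; exact: le_trans.
Qed.

Lemma poisson_prob_set1 s k : 0 <= s ->
  poisson_prob s 0 [set k] = (expR (- s) * (s ^+ k / k`!%:R))%:E.
Proof.
rewrite le_eqVlt => /predU1P[<-|s0]; rewrite /poisson_prob.
  (* At s = 0 the convention 0^0 = 1 turns the formula into the point mass at 0. *)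
  rewrite ltxx oppr0 expR0 mul1r diracE expr0n.
  case: k => [|k]; first by rewrite fact0 divr1 mem_set.
  by rewrite mul0r memNset.
rewrite s0 esum_set1 ?lee_fin ?poisson_pmf_ge0// /poisson_pmf s0.
by rewrite [in RHS]mulrC.
Qed.

Lemma integral_poisson h M s : bounded_by M h -> (forall k, 0 <= h k) ->
  0 <= s -> (\int[poisson_prob s 0]_k (h k)%:E = (poisson_mean h s)%:E)%E.
Proof.
move=> hM h0 s0; have -> : [set: nat] = \bigcup_k [set k].
  by apply/seteqP; split => // k _; exists k.
rewrite ge0_integral_bigcup//; [|by move=> k _; rewrite lee_fin|]; last first.
  by move=> i j _ _ [k [/= -> ->]].
have cE : (limn (pseries (poisson_coef h) s))%:E =
    (\sum_(0 <= k <oo) (poisson_coef h k * s ^+ k)%:E)%E.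
  rewrite -(EFin_lim (cvg_poisson_coef hM)); apply/congr_lim/funext => n.
  by rewrite /= sumEFin.
rewrite [RHS]EFinM cE.
rewrite -nneseriesZl; last first.
  by move=> k _; rewrite lee_fin mulr_ge0 ?exprn_ge0 ?divr_ge0.
apply: eq_eseriesr => k _.
rewrite (eq_integral (cst (h k)%:E)); last by move=> j; rewrite inE => ->.
rewrite integral_cst//.
apply: etrans (congr1 (fun z => (h k)%:E * z)%E (poisson_prob_set1 k s0)) _.
by rewrite -!EFinM /poisson_coef; congr EFin; ring.
Qed.

End PoissonAverage.

(** * The Markov operator on bounded Lipschitz functions *)

Section TestFunctions.
Context {R : realType}.
Implicit Types (g h : R -> R).

Definition lipschitz_by (B : R) g := forall s t, `|g s - g t| <= B * `|s - t|.

(** The class of test functions: it contains the ramps, separates probabilities on the line and is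
    stable under the Markov operator. *)
Definition bounded_lipschitz g :=
  (exists M, bounded_by M g) /\ (exists2 B, 0 <= B & lipschitz_by B g).

Lemma bounded_lipschitz_cst (c : R) : bounded_lipschitz (cst c).
Proof.
split; [by exists `|c| => k|exists 0 => //].
by move=> s t; rewrite subrr normr0 mul0r.
Qed.

Lemma bounded_lipschitzD g h : bounded_lipschitz g -> bounded_lipschitz h ->
  bounded_lipschitz (fun x => g x + h x).
Proof.
move=> [[M gM] [B B0 gB]] [[M' hM] [B' B0' hB]]; split.
  by exists (M + M') => x; rewrite (le_trans (ler_normD _ _))// lerD.
exists (B + B'); first exact: addr_ge0.
move=> s t; rewrite opprD addrACA (le_trans (ler_normD _ _))// mulrDl lerD//.
Qed.

Lemma bounded_lipschitzZ (c : R) g : bounded_lipschitz g ->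
  bounded_lipschitz (fun x => c * g x).
Proof.
move=> [[M gM] [B B0 gB]]; split.
  by exists (`|c| * M) => x; rewrite normrM ler_wpM2l.
exists (`|c| * B); first exact: mulr_ge0.
by move=> s t; rewrite -mulrBr normrM -mulrA ler_wpM2l.
Qed.

Lemma lipschitz_by_continuous B g : lipschitz_by B g -> continuous g.
Proof.
move=> gB x; apply/cvgrPdist_le => e e0.
have B0 : 0 <= B by rewrite -(pmulr_lge0 _ ltr01); have := gB 1 0;
  rewrite subr0 normr1; exact: le_trans.
have B1 : 0 < B + 1 by rewrite ltr_wpDl.
near=> y; rewrite (le_trans (gB _ _))//.
rewrite (@le_trans _ _ ((B + 1) * `|x - y|))//.
  by rewrite ler_wpM2r// lerDl.
rewrite mulrC -ler_pdivlMr//; near: y.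
by apply: cvgr_dist_le; [exact: cvg_id|exact: divr_gt0].
Unshelve. all: by end_near. Qed.

(** Abstract form of the expectation under a law carried by [0, oo): monotonicity only compares
    values at nonnegative arguments. *)
Definition mean_functional (L : (R -> R) -> R) :=
  [/\ forall c : R, L (cst c) = c,
      forall g h, bounded_lipschitz g -> bounded_lipschitz h ->
        L (fun x => g x + h x) = L g + L h,
      forall (c : R) g, bounded_lipschitz g -> L (fun x => c * g x) = c * L g &
      forall g h, bounded_lipschitz g -> bounded_lipschitz h ->
        (forall x, 0 <= x -> g x <= h x) -> L g <= L h].

End TestFunctions.

(** * Contraction of the Markov operator and the limit of its iterates *)

Section MeanOperator.
Context {R : realType}.
Variables (f : R -> nat -> R) (k1 k2 : R).
Hypotheses (f_ge0 : forall l y, 0 <= l -> 0 <= f l y)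
  (k1_ge0 : 0 <= k1) (k2_ge0 : 0 <= k2) (k12_lt1 : k1 + k2 < 1)
  (f_contr : forall l l' (y y' : nat), 0 <= l -> 0 <= l' ->
      `|f l y - f l' y'| <= k1 * `|l - l'| + k2 * `|y%:R - y'%:R|).
Implicit Types (g h : R -> R).

(** Truncation at 0 extends the intensity map to the whole line. It is 1-Lipschitz and the identity
    on the state space, so the contraction estimates survive. *)
Definition next_intensity (x : nat * R) : R := f (Num.max x.2 0) x.1.

Lemma next_intensity_ge0 x : 0 <= next_intensity x.
Proof. by apply: f_ge0; rewrite le_max lexx orbT. Qed.

Definition transition_op g (s : R) : R :=
  poisson_mean (fun k => g (next_intensity (k, s))) (Num.max s 0).

Local Notation K := transition_op.

Let max0_ge0 (s : R) : 0 <= Num.max s 0.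
Proof. by rewrite le_max lexx orbT. Qed.

Lemma transition_op_bounded M g : bounded_by M g -> bounded_by M (K g).
Proof. by move=> gM s; apply: poisson_mean_bounded => // k. Qed.

(** Moving from s to t changes the argument of [f], which costs [k1], and the Poisson parameter,
    which costs [k2] because consecutive counts differ by 1. The two changes are made one after the
    other. *)
Lemma transition_op_lipschitz M B g : 0 <= B -> bounded_by M g ->
  lipschitz_by B g -> lipschitz_by ((k1 + k2) * B) (K g).
Proof.
move=> B0 gM gB s t; rewrite /transition_op.
have fM u : bounded_by M (fun k : nat => g (next_intensity (k, u))) by move=> k.
have NfM u : bounded_by M (fun k : nat => -1 * g (next_intensity (k, u))).
  by move=> k; rewrite mulN1r normrN.
set S := Num.max s 0; set T := Num.max t 0.
have S0 : 0 <= S by exact: max0_ge0.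
have T0 : 0 <= T by exact: max0_ge0.
have ST : `|S - T| <= `|s - t|.
  have st := ler_norm (s - t); have ts := ler_norm (t - s).
  rewrite distrC in ts; rewrite ler_norml /S /T.
  by case: (leP s 0) => s0; case: (leP t 0) => t0; lra.
apply: (@le_trans _ _ (B * (k1 * `|S - T|) + B * k2 * `|S - T|)); last first.
  rewrite -mulrA -mulrDr -mulrDl mulrCA -mulrA ler_wpM2l// ?addr_ge0//.
  by rewrite ler_wpM2l.
rewrite -(subrK (poisson_mean (fun k => g (next_intensity (k, t))) S)
  (poisson_mean _ S)) -addrA (le_trans (ler_normD _ _))// lerD//.
  rewrite -mulN1r -(poisson_meanZ _ _ (fM t)) -(poisson_meanD _ (fM s) (NfM t)).
  apply: poisson_mean_bounded S0 => k; rewrite mulN1r.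
  rewrite (le_trans (gB _ _))// ler_wpM2l//.
  by rewrite (le_trans (f_contr _ _ _ _))// subrr normr0 mulr0 addr0.
apply: (poisson_mean_lipschitz (fM t) _ S0 T0) => k.
rewrite (le_trans (gB _ _))// ler_wpM2l//.
rewrite (le_trans (f_contr _ _ _ _))// subrr normr0 mulr0 add0r.
by rewrite -natrB// subSnn normr1 mulr1.
Qed.

Lemma transition_op_bl g : bounded_lipschitz g -> bounded_lipschitz (K g).
Proof.
move=> [[M gM] [B B0 gB]]; split; first by exists M; exact: transition_op_bounded.
exists ((k1 + k2) * B); first by rewrite mulr_ge0// addr_ge0.
exact: transition_op_lipschitz gM gB.
Qed.

Lemma transition_op0 g : K g 0 = g (f 0 0%N).
Proof. by rewrite /transition_op maxxx poisson_mean0 /next_intensity/= maxxx. Qed.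

Let kappa := k1 + k2.
Let kappa_ge0 : 0 <= kappa. Proof. exact: addr_ge0. Qed.

Lemma iter_transition_op_bounded n M g :
  bounded_by M g -> bounded_by M (iter n K g).
Proof. by move=> gM; elim: n => //= n; exact: transition_op_bounded. Qed.

Lemma iter_transition_op_lipschitz n M B g : 0 <= B -> bounded_by M g ->
  lipschitz_by B g -> lipschitz_by (kappa ^+ n * B) (iter n K g).
Proof.
move=> B0 gM gB; elim: n => [|n IH]; first by rewrite expr0 mul1r.
rewrite exprS -mulrA iterS; apply: transition_op_lipschitz IH.
  by rewrite mulr_ge0// exprn_ge0.
exact: iter_transition_op_bounded gM.
Qed.

Lemma iter_transition_op_bl n g :
  bounded_lipschitz g -> bounded_lipschitz (iter n K g).
Proof. by move=> gbl; elim: n => //= n; exact: transition_op_bl. Qed.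

Lemma transition_op_mean s : 0 <= s -> mean_functional (K ^~ s).
Proof.
move=> s0; split => [c|g h [[M gM] _] [[M' hM] _]|c g [[M gM] _]|].
- exact: poisson_mean_cst.
- exact: (@poisson_meanD _ _ _ M M').
- exact: (@poisson_meanZ _ _ M).
- move=> g h [[M gM] _] [[M' hM] _] gh.
  by apply: (@le_poisson_mean _ _ _ M M') => // k; apply/gh/next_intensity_ge0.
Qed.

Lemma iter_transition_op_mean n s :
  0 <= s -> mean_functional (fun g => iter n K g s).
Proof.
elim: n s => [|n IH] s s0; first by split => // g h _ _; exact.
have [K1 KD KZ Kle] := transition_op_mean s0.
(* [K g s] sees [g] only at nonnegative arguments, exactly where the induction hypothesis is
   available. *)
have gE g h : (forall x, 0 <= x -> g x = h x) -> K g s = K h s.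
  move=> gh; congr poisson_mean; apply/funext => k.
  exact/gh/next_intensity_ge0.
split => [c|g h gbl hbl|c g gbl|g h gbl hbl gh]; rewrite ?iterS.
- by rewrite -[RHS]K1; apply: gE => x /IH[+ _ _ _]; exact.
- rewrite -KD; [|exact: iter_transition_op_bl..].
  by apply: gE => x /IH[_ + _ _]; exact.
- rewrite -KZ; last exact: iter_transition_op_bl.
  by apply: gE => x /IH[_ _ + _]; exact.
- apply: Kle; [exact: iter_transition_op_bl..|] => x x0.
  by have [_ _ _] := IH _ x0; exact.
Qed.

Lemma iter_transition_op_step n B g : 0 <= B -> bounded_lipschitz g ->
  lipschitz_by B g ->
  `|iter n.+1 K g 0 - iter n K g 0| <= B * f 0 0%N * kappa ^+ n.
Proof.
move=> B0 [[M gM] _] gB; rewrite iterS transition_op0.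
rewrite (le_trans (iter_transition_op_lipschitz n B0 gM gB _ _))//.
by rewrite subr0 (ger0_norm (f_ge0 _ _))// [leRHS]mulrC mulrA.
Qed.

Definition stationary_mean g : R := limn (fun n => iter n K g 0).

Lemma cvg_stationary_mean g : bounded_lipschitz g ->
  iter n K g 0 @[n --> \oo] --> stationary_mean g.
Proof.
move=> gbl; have [_ [B B0 gB]] := gbl.
pose u n := iter n K g 0.
(* The sequence is a telescoping series whose terms are dominated by a geometric one of ratio
   [kappa]. *)
suff : cvgn (series (telescope u)).
  move=> ct; suff : cvgn u by [].
  rewrite (_ : u = (fun n => u 0%N + series (telescope u) n)).
    exact: (is_cvgD (is_cvg_cst _) ct).
  by apply/funext => n; rewrite -eq_sum_telescope.
apply: normed_cvg.
apply: (@series_le_cvg _ _ (geometric (B * f 0 0%N) kappa)).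
- by move=> n /=.
- by move=> n /=; rewrite mulr_ge0 ?exprn_ge0// mulr_ge0// f_ge0.
- by move=> n; exact: iter_transition_op_step.
- by apply: is_cvg_geometric_series; rewrite ger0_norm.
Qed.

(** The Lipschitz constant of the n-th iterate is at most [kappa ^+ n * B], so the values at [s] and
    at 0 merge. *)
Lemma cvg_iter_transition_op g s : bounded_lipschitz g ->
  iter n K g s @[n --> \oo] --> stationary_mean g.
Proof.
move=> gbl; have [[M gM] [B B0 gB]] := gbl.
have -> : (fun n => iter n K g s) =
    (fun n => (iter n K g s - iter n K g 0) + iter n K g 0).
  by apply/funext => n; rewrite subrK.
rewrite -[X in _ --> X]add0r; apply: cvgD; last exact: cvg_stationary_mean.
apply: norm_cvg0.
apply: (@squeeze_cvgr _ _ _ _ (cst 0) (geometric (B * `|s|) kappa)).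
- near=> n; rewrite normr_ge0/=.
  rewrite (le_trans (iter_transition_op_lipschitz n B0 gM gB _ _))//.
  by rewrite subr0 /= [leRHS]mulrC mulrA.
- exact: cvg_cst.
- by apply: cvg_geometric; rewrite ger0_norm.
Unshelve. all: by end_near. Qed.

(** Invariance is a shift of index: the iterates of [K g] are those of [g] without the first. *)
Lemma stationary_mean_op g : bounded_lipschitz g ->
  stationary_mean (K g) = stationary_mean g.
Proof.
move=> gbl; apply/cvg_lim => //.
have := cvg_stationary_mean gbl; rewrite -(cvg_shiftS (fun n => iter n K g 0)).
by under eq_fun do rewrite iterSr.
Qed.

Lemma stationary_mean_functional : mean_functional stationary_mean.
Proof.
have Kn n := iter_transition_op_mean n (lexx 0).
split => [c|g h gbl hbl|c g gbl|g h gbl hbl gh].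
- apply/cvg_lim => //; under eq_fun => n do rewrite (let: And4 K1 _ _ _ := Kn n in K1 c).
  exact: cvg_cst.
- apply/cvg_lim => //.
  under eq_fun => n do rewrite (let: And4 _ KD _ _ := Kn n in KD g h gbl hbl).
  by apply: cvgD; exact: cvg_stationary_mean.
- apply/cvg_lim => //.
  under eq_fun => n do rewrite (let: And4 _ _ KZ _ := Kn n in KZ c g gbl).
  by apply: cvgMl_tmp; exact: cvg_stationary_mean.
- apply: (ler_lim (cvgP _ (cvg_stationary_mean gbl)) (cvgP _ (cvg_stationary_mean hbl))).
  by near=> n; have [_ _ _] := Kn n; exact.
Unshelve. all: by end_near. Qed.

(** Sum of the geometric step bounds. This one estimate yields tightness, the finite mean, and the
    point mass at 0 when [f 0 0] vanishes. *)
Lemma stationary_mean_dist0 B g : 0 <= B -> bounded_lipschitz g ->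
  lipschitz_by B g -> `|stationary_mean g - g 0| <= B * f 0 0%N / (1 - kappa).
Proof.
move=> B0 gbl gB; have kappa_lt1 : 0 < 1 - kappa by rewrite subr_gt0.
have f00 := f_ge0 0%N (lexx 0).
(* The finite geometric sum is kept in closed form so that the induction closes. *)
have bnd n : `|iter n K g 0 - g 0| <= B * f 0 0%N / (1 - kappa) * (1 - kappa ^+ n).
  elim: n => [|n IH]; first by rewrite subrr normr0 expr0 subrr mulr0.
  rewrite -(subrK (iter n K g 0) (iter n.+1 K g 0)) -addrA.
  rewrite (le_trans (ler_normD _ _))//.
  rewrite (le_trans (lerD (iter_transition_op_step n B0 gbl gB) IH))//.
  rewrite exprS le_eqVlt; apply/orP; left; apply/eqP; field.
  exact: lt0r_neq0.
have cg : `|iter n K g 0 - g 0| @[n --> \oo] --> `|stationary_mean g - g 0|.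
  apply: cvg_norm; apply: cvgB; last exact: cvg_cst.
  exact: cvg_stationary_mean.
apply: (cvgr_to_le cg); near=> n.
rewrite (le_trans (bnd n))// ler_piMr ?gerBl ?exprn_ge0//.
by rewrite divr_ge0 ?(ltW kappa_lt1)// mulr_ge0.
Unshelve. all: by end_near. Qed.

End MeanOperator.

(** * From a positive functional to a distribution function *)

Section Ramp.
Context {R : realType}.
Implicit Types (a w t : R).

Definition clamp (u : R) : R := Num.max 0 (Num.min 1 u).

Lemma clamp_ge0 u : 0 <= clamp u.
Proof. by rewrite /clamp le_max lexx. Qed.

Lemma clamp_le1 u : clamp u <= 1.
Proof. by rewrite /clamp ge_max ler01 ge_min lexx. Qed.

Lemma clamp_lipschitz u v : `|clamp u - clamp v| <= `|u - v|.
Proof.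
have uv := ler_norm (u - v); have vu := ler_norm (v - u).
rewrite distrC in vu; rewrite ler_norml /clamp.
by case: (leP 1 u) => u1; case: (leP 1 v) => v1; rewrite ?(max_r ler01);
  do ?[case: (leP 0 u) => u0]; do ?[case: (leP 0 v) => v0]; lra.
Qed.

Lemma le_clamp u v : u <= v -> clamp u <= clamp v.
Proof.
move=> uv; rewrite /clamp.
by case: (leP 1 u) => u1; case: (leP 1 v) => v1; rewrite ?(max_r ler01);
  do ?[case: (leP 0 u) => u0]; do ?[case: (leP 0 v) => v0]; lra.
Qed.

(** Equal to 1 up to [a], to 0 from [a + w] on, and affine between: a Lipschitz majorant of the
    indicator of []-oo, a]]. *)
Definition ramp a w t : R := clamp ((a - t) / w + 1).

Lemma ramp_ge0 a w t : 0 <= ramp a w t. Proof. exact: clamp_ge0. Qed.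

Lemma ramp_le1 a w t : ramp a w t <= 1. Proof. exact: clamp_le1. Qed.

Lemma ramp_eq1 a w t : 0 < w -> t <= a -> ramp a w t = 1.
Proof.
move=> w0 ta; rewrite /ramp /clamp min_l ?(max_r ler01)//.
by rewrite lerDr divr_ge0 ?subr_ge0// ltW.
Qed.

Lemma ramp_eq0 a w t : 0 < w -> a + w <= t -> ramp a w t = 0.
Proof.
move=> w0 at_; rewrite /ramp /clamp max_l// ge_min; apply/orP; right.
by rewrite -lerBrDr sub0r ler_pdivrMr// mulN1r lerBlDr addrC -lerBlDr opprK.
Qed.

Lemma le_ramp a a' w t : 0 < w -> a <= a' -> ramp a w t <= ramp a' w t.
Proof.
move=> w0 aa'; apply: le_clamp; rewrite lerD2r ler_pM2r ?invr_gt0//.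
by rewrite lerD2r.
Qed.

(** The left ramp has reached 0 before the right one leaves 1. *)
Lemma ramp_le_ramp a a' w w' t : 0 < w -> 0 < w' -> a + w <= a' ->
  ramp a w t <= ramp a' w' t.
Proof.
move=> w0 w'0 aa'; have [ta|ta] := leP (a + w) t.
  by rewrite (ramp_eq0 w0 ta) ramp_ge0.
by rewrite [leRHS]ramp_eq1 ?ramp_le1// (le_trans (ltW ta)).
Qed.

Lemma ramp_shift a a' w t : 0 < w -> `|ramp a w t - ramp a' w t| <= `|a - a'| / w.
Proof.
move=> w0; rewrite (le_trans (clamp_lipschitz _ _))//.
rewrite opprD addrACA subrr addr0 -mulrBl opprB addrA subrK normrM.
by rewrite [X in _ * X]gtr0_norm ?invr_gt0.
Qed.

Lemma ramp_lipschitz a w : 0 < w -> lipschitz_by w^-1 (ramp a w).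
Proof.
move=> w0 s t; rewrite (le_trans (clamp_lipschitz _ _))//.
rewrite opprD addrACA subrr addr0 -mulrBl normrM.
rewrite [X in _ * X]gtr0_norm ?invr_gt0// mulrC ler_pM2l ?invr_gt0//.
have -> : a - s - (a - t) = t - s by ring.
by rewrite distrC.
Qed.

Lemma ramp_bounded a w : bounded_by 1 (ramp a w).
Proof. by move=> t; rewrite ger0_norm ?ramp_ge0// ramp_le1. Qed.

Lemma ramp_bl a w : 0 < w -> bounded_lipschitz (ramp a w).
Proof.
move=> w0; split; first by exists 1; exact: ramp_bounded.
by exists w^-1; [rewrite invr_ge0 ltW|exact: ramp_lipschitz].
Qed.

End Ramp.

(** * The distribution function of a tight positive functional *)

Section Cdf.
Context {R : realType}.
Variable L : (R -> R) -> R.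
Hypothesis Lmean : mean_functional L.
Hypothesis Ltight : forall e : R, 0 < e -> exists2 a, 0 < a & 1 - e <= L (ramp 0 a).

Let le_mean g h (c : R) : bounded_lipschitz g -> bounded_lipschitz h ->
  (forall x, 0 <= x -> g x <= h x + c) -> L g <= L h + c.
Proof.
move=> gbl hbl gh; have [L1 LD _ Lle] := Lmean.
rewrite -[in leRHS](L1 c) -LD//; last exact: bounded_lipschitz_cst.
apply: Lle => //; apply: bounded_lipschitzD => //; exact: bounded_lipschitz_cst.
Qed.

(** As [w] decreases to 0 the ramps decrease to the indicator of []-oo, a]], so for an expectation
    this is the probability of that ray. *)
Definition mean_cdf (a : R) : R := inf [set L (ramp a w) | w in [set w | 0 < w]].

Let lb_ramps a : lbound [set L (ramp a w) | w in [set w | 0 < w]] 0.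
Proof.
move=> _ [w /= w0 <-]; have [L1 _ _ Lle] := Lmean.
rewrite -(L1 0); apply: Lle => [||x _]; first exact: bounded_lipschitz_cst.
  exact: ramp_bl.
exact: ramp_ge0.
Qed.

Let ramps0 a : [set L (ramp a w) | w in [set w | 0 < w]] !=set0.
Proof. by exists (L (ramp a 1)), 1 => //=. Qed.

Lemma mean_cdf_le a w : 0 < w -> mean_cdf a <= L (ramp a w).
Proof.
by move=> w0; apply: ge_inf; [exists 0; exact: lb_ramps|exists w].
Qed.

(** Together with [mean_cdf_le] this sandwiches the values on ramps, which is the link between [L]
    and [mean_cdf] used to represent [L]. *)
Lemma mean_cdf_ge a w : 0 < w -> L (ramp a w) <= mean_cdf (a + w).
Proof.
move=> w0; apply: lb_le_inf => // _ [w' /= w'0 <-].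
have [_ _ _ Lle] := Lmean; apply: Lle => [||x _]; [exact: ramp_bl..|].
exact: ramp_le_ramp.
Qed.

Lemma mean_cdf_ge0 a : 0 <= mean_cdf a.
Proof. by apply: lb_le_inf. Qed.

Lemma mean_cdf_le1 a : mean_cdf a <= 1.
Proof.
rewrite (le_trans (mean_cdf_le a ltr01))//; have [L1 _ _ Lle] := Lmean.
rewrite -[leRHS]L1; apply: Lle => [||x _]; first exact: ramp_bl.
  exact: bounded_lipschitz_cst.
exact: ramp_le1.
Qed.

Lemma mean_cdf_nd : nondecreasing mean_cdf.
Proof.
move=> a b ab; apply: lb_le_inf => // _ [w /= w0 <-].
rewrite (le_trans (mean_cdf_le a w0))//.
have [_ _ _ Lle] := Lmean; apply: Lle => [||x _]; [exact: ramp_bl..|].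
exact: le_ramp.
Qed.

Lemma mean_cdf_rc : right_continuous mean_cdf.
Proof.
move=> a; apply/cvgrPdist_le => e e0.
have e2 : 0 < e / 2 by rewrite divr_gt0.
have [_ [w /= w0 <-] Fw] : exists2 x, [set L (ramp a w) | w in [set w | 0 < w]] x &
    x < mean_cdf a + e / 2.
  by apply: inf_adherent => //; split => //; exists 0; exact: lb_ramps.
near=> y.
have ay : a <= y by near: y; exact: nbhs_right_ge.
(* A ramp of near-optimal width [w] at [a] also serves at [y]: shifting it raises it by at most (y -
   a) / w, hence this radius. *)
have yw : y <= a + e / 2 * w.
  by near: y; apply: nbhs_right_le; rewrite ltrDl mulr_gt0.
rewrite ler_norml; apply/andP; split; last first.
  by rewrite lerBlDr (le_trans (mean_cdf_nd ay))// lerDr ltW.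
rewrite lerBrDl; rewrite -lerBrDr opprK.
rewrite (le_trans (mean_cdf_le y w0))//.
rewrite (@le_trans _ _ (L (ramp a w) + e / 2))//; last by lra.
apply: le_mean => [||x _]; [exact: ramp_bl..|].
rewrite -lerBlDl (le_trans (ler_norm _))// (le_trans (ramp_shift _ _ _ w0))//.
by rewrite ler_pdivrMr// ger0_norm ?subr_ge0// lerBlDl.
Unshelve. all: by end_near. Qed.

Lemma mean_cdf_lt0 a : a < 0 -> mean_cdf a = 0.
Proof.
move=> a0; apply/eqP; rewrite eq_le mean_cdf_ge0 andbT.
(* With width [- a] the ramp at [a] vanishes on [0, oo), the only place where [L] compares
   functions. *)
have a0' : 0 < - a by rewrite oppr_gt0.
rewrite (le_trans (mean_cdf_le a a0'))//; have [L1 _ _ Lle] := Lmean.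
rewrite -[leRHS]L1; apply: Lle => [||x x0]; first exact: ramp_bl.
  exact: bounded_lipschitz_cst.
by rewrite ramp_eq0// subrr.
Qed.

Lemma mean_cdfNy : mean_cdf @ -oo --> (0 : R).
Proof.
apply: cvg_near_cst; near=> a.
by apply: mean_cdf_lt0; near: a; by apply: nbhs_ninfty_lt; exact: num_real.
Unshelve. all: by end_near. Qed.

Lemma mean_cdfy : mean_cdf @ +oo --> (1 : R).
Proof.
apply/cvgrPdist_le => e e0; have [a a0 La] := Ltight e0.
near=> x; rewrite ger0_norm ?subr_ge0 ?mean_cdf_le1//.
rewrite lerBlDl -lerBlDr (le_trans La)// (le_trans (mean_cdf_ge 0 a0))//.
rewrite add0r; apply: mean_cdf_nd; near: x; by apply: nbhs_pinfty_ge; exact: num_real.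
Unshelve. all: by end_near. Qed.

HB.instance Definition _ := isCumulative.Build R _ R mean_cdf mean_cdf_nd mean_cdf_rc.
HB.instance Definition _ := isCumulativeBounded.Build R 0 1 mean_cdf mean_cdfNy mean_cdfy.

(* lebesgue_stieltjes_measure lives on measurableTypeR R, whose display is not
   the one of the canonical Borel structure of R: the identity transports it. *)
Let idTR : measurableTypeR R -> R := idfun.

#[local] HB.instance Definition _ :=
  @isMeasurableFun.Build _ _ _ _ idTR (@measurable_id _ _ setT).

Lemma mean_cdf_measure :
  exists mu : probability R R, forall a, mu `]-oo, a]%classic = (mean_cdf a)%:E.
Proof.
pose P : probability (measurableTypeR R) R := lebesgue_stieltjes_measure mean_cdf.
exists (distribution P (idTR : {RV P >-> R})) => a.
exact: (cdf_lebesgue_stieltjes_id mean_cdf a).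
Qed.

End Cdf.

(** * Functionals are determined by their values on ramps *)

Section Approximation.
Context {R : realType}.
Variables (F : R -> R) (g : R -> R) (M B : R).
Hypotheses (F_ge0 : forall a, 0 <= F a)
  (F_le1 : forall a, F a <= 1) (gM : bounded_by M g) (B_ge0 : 0 <= B)
  (gB : lipschitz_by B g).
Variable d : R.
Hypothesis d_gt0 : 0 < d.

Let x (n : nat) : R := n%:R * d.

Let xS n : x n.+1 = x n + d.
Proof. by rewrite /x -natr1 mulrDl mul1r. Qed.

Let x_ge0 n : 0 <= x n. Proof. by rewrite mulr_ge0// ltW. Qed.

(* The piecewise affine function equal to g at the points i * d for i <= n
   and constant outside [0, n * d]. *)
Fixpoint interpolant (n : nat) : R -> R :=
  if n is n'.+1 then
    fun t => interpolant n' t + (g (x n) - g (x n')) * (1 + (-1) * ramp (x n') d t)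
  else cst (g (x 0)).

Let step_bl n : bounded_lipschitz (fun t => 1 + (-1) * ramp (x n) d t).
Proof.
apply: (@bounded_lipschitzD _ (cst 1)); first exact: bounded_lipschitz_cst.
exact/bounded_lipschitzZ/ramp_bl.
Qed.

Let interpolant_bl n : bounded_lipschitz (interpolant n).
Proof.
elim: n => [|n IH]; first exact: bounded_lipschitz_cst.
by apply: bounded_lipschitzD => //; exact: bounded_lipschitzZ.
Qed.

Let interpolant_last n t : x n <= t -> interpolant n t = g (x n).
Proof.
elim: n t => [//|n IH] t /=; rewrite {1}xS => xt.
rewrite IH; last by rewrite (le_trans _ xt)// lerDl ltW.
by rewrite ramp_eq0// mulr0 addr0 mulr1 addrC subrK.
Qed.

Let interpolant_dist n t : 0 <= t -> t <= x n -> `|interpolant n t - g t| <= B * d.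
Proof.
have gd (u v : R) : `|u - v| <= d -> `|g u - g v| <= B * d.
  by move=> uv; rewrite (le_trans (gB _ _))// ler_wpM2l.
elim: n => [|n IH] t0 tx.
  rewrite (_ : t = x 0) ?subrr ?normr0 ?mulr_ge0 ?(ltW d_gt0)//.
  by apply/eqP; rewrite eq_le tx /x mul0r.
have [tn|/ltW tn] := leP t (x n).
  by rewrite /= ramp_eq1// mulr1 subrr mulr0 addr0 IH.
rewrite /= (interpolant_last tn); set r := ramp _ _ _.
have r0 : 0 <= r by exact: ramp_ge0.
have r1 : r <= 1 by exact: ramp_le1.
(* On a grid cell the interpolant is a convex combination of the values of [g] at the two ends, both
   within [d] of [t]. *)
rewrite (_ : _ - g t = r * (g (x n) - g t) + (1 - r) * (g (x n.+1) - g t)); last by ring.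
rewrite (le_trans (ler_normD _ _))// !normrM (ger0_norm r0).
rewrite (_ : `|1 - r| = 1 - r); last by rewrite ger0_norm ?subr_ge0.
rewrite xS in tx.
have -> : B * d = r * (B * d) + (1 - r) * (B * d) by ring.
rewrite lerD// ler_wpM2l ?subr_ge0// gd// ler_norml ?xS; apply/andP; split; lra.
Qed.

(** Beyond [x n.+1] both functions are only known to be bounded by [M]; the tail is cut off by a
    complementary ramp rather than an indicator, so that a functional can be applied to the
    bound. *)
Let interpolant_tail n t : 0 <= t ->
  `|interpolant n.+1 t - g t| <= B * d + 2 * M * (1 + (-1) * ramp (x n) d t).
Proof.
have M0 : 0 <= M by exact: le_trans (gM 0).
move=> t0; have [tx|/ltW tx] := leP t (x n.+1).
  rewrite (le_trans (interpolant_dist t0 tx))// lerDl !mulr_ge0//.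
  by rewrite mulN1r subr_ge0 ramp_le1.
rewrite interpolant_last// ramp_eq0 -?xS// mulr0 addr0 mulr1.
rewrite (le_trans (ler_normB _ _))// (le_trans (lerD (gM _) (gM _)))//.
by have := mulr_ge0 B_ge0 (ltW d_gt0); lra.
Qed.

(* The value of interpolant n under a functional which agrees with F on ramps. *)
Fixpoint interpolant_sum (n : nat) : R :=
  if n is n'.+1 then
    interpolant_sum n' + (g (x n) - g (x n')) * (1 + (-1) * F (x n'))
  else g (x 0).

(** [interpolant_sum] depends on [F] but not on [L], so two functionals sandwiched by the same [F]
    are close. One [B * d] comes from interpolating [g], the other from replacing ramp values by
    values of [F]. *)
Lemma mean_functional_approx (L : (R -> R) -> R) : mean_functional L ->
  (forall a w, 0 < w -> F a <= L (ramp a w) <= F (a + w)) ->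
  forall n, `|L g - interpolant_sum n.+1| <= 2 * B * d + 2 * M * (1 - F (x n)).
Proof.
move=> [L1 LD LZ Lle] LF n.
have M0 : 0 <= M by exact: le_trans (gM 0).
have gbl : bounded_lipschitz g by split; [exists M|exists B].
have Lstep k : L (fun t => 1 + (-1) * ramp (x k) d t) = 1 - L (ramp (x k) d).
  rewrite (LD (cst 1)) ?L1 ?LZ ?mulN1r//; [exact: ramp_bl|exact: bounded_lipschitz_cst|].
  exact/bounded_lipschitzZ/ramp_bl.
(* Each replacement costs at most [B * d] times the increment of [F] over the cell, and the
   increments telescope. *)
have sumE k : `|L (interpolant k) - interpolant_sum k| <= B * d * (F (x k) - F (x 0)).
  elim: k => [|k IH]; first by rewrite /= L1 !subrr normr0 mulr0.
  rewrite /= LD//; last exact: bounded_lipschitzZ.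
  rewrite LZ// Lstep.
  have /andP[F1 F2] := LF (x k) d d_gt0; rewrite -xS in F2.
  rewrite (_ : _ - _ = L (interpolant k) - interpolant_sum k +
    (g (x k.+1) - g (x k)) * (F (x k) - L (ramp (x k) d))); last by ring.
  rewrite (le_trans (ler_normD _ _))// (le_trans (lerD IH (lexx _)))// normrM.
  rewrite (_ : F (x k.+1) - _ = F (x k) - F (x 0) + (F (x k.+1) - F (x k))); last by ring.
  rewrite [leRHS]mulrDr lerD2l ler_pM//.
    rewrite (le_trans (gB _ _))// xS addrAC subrr add0r.
    by rewrite gtr0_norm.
  by rewrite distrC ger0_norm ?subr_ge0// lerD2r.
have {}sumE : `|L (interpolant n.+1) - interpolant_sum n.+1| <= B * d.
  rewrite (le_trans (sumE _))// ler_piMr ?mulr_ge0 ?(ltW d_gt0)//.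
  by rewrite lerBlDr (le_trans (F_le1 _))// lerDl.
have tailE : `|L g - L (interpolant n.+1)| <= B * d + 2 * M * (1 - F (x n)).
  have tbl : bounded_lipschitz (fun t => B * d + 2 * M * (1 + (-1) * ramp (x n) d t)).
    apply: (@bounded_lipschitzD _ (cst (B * d))); first exact: bounded_lipschitz_cst.
    exact: bounded_lipschitzZ.
  have Lt : L (fun t => B * d + 2 * M * (1 + (-1) * ramp (x n) d t)) <=
      B * d + 2 * M * (1 - F (x n)).
    rewrite (LD (cst (B * d))) ?L1 ?LZ ?Lstep//; last 2 first.
    - exact: bounded_lipschitz_cst.
    - exact: bounded_lipschitzZ.
    rewrite lerD2l ler_wpM2l ?mulr_ge0// lerD2l lerN2.
    by have /andP[] := LF (x n) d d_gt0.
  have Lsub h1 h2 : bounded_lipschitz h1 -> bounded_lipschitz h2 ->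
      (forall t, 0 <= t -> h1 t - h2 t <=
         B * d + 2 * M * (1 + (-1) * ramp (x n) d t)) ->
      L h1 - L h2 <= B * d + 2 * M * (1 - F (x n)).
    move=> h1bl h2bl h12; rewrite lerBlDr (le_trans _ (lerD Lt (lexx _)))//.
    rewrite -LD//; apply: Lle => //; first exact: bounded_lipschitzD.
    by move=> t t0; rewrite -lerBlDr h12.
  rewrite ler_norml lerNl opprB; apply/andP; split; apply: Lsub => // t t0.
    exact: le_trans (ler_norm _) (interpolant_tail _ t0).
  by rewrite (le_trans (ler_norm _))// distrC interpolant_tail.
rewrite -(subrK (L (interpolant n.+1)) (L g)) -addrA (le_trans (ler_normD _ _))//.
rewrite (le_trans (lerD tailE sumE))//; lra.
Qed.

End Approximation.

Lemma mean_functional_eq (R : realType) (F : R -> R) (L L' : (R -> R) -> R) :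
  nondecreasing F -> (forall a, 0 <= F a) -> (forall a, F a <= 1) ->
  F @ +oo --> (1 : R) ->
  mean_functional L -> mean_functional L' ->
  (forall a w, 0 < w -> F a <= L (ramp a w) <= F (a + w)) ->
  (forall a w, 0 < w -> F a <= L' (ramp a w) <= F (a + w)) ->
  forall g, bounded_lipschitz g -> L g = L' g.
Proof.
move=> F_nd F_ge0 F_le1 Fy Lm L'm LF L'F g [[M gM] [B B0 gB]].
have M0 : 0 <= M by exact: le_trans (gM 0).
apply/eqP; rewrite -subr_eq0 -normr_le0; apply/ler_addgt0Pl => e e0.
rewrite addr0.
(* [e1] is both the mesh and the tolerance for the tail. The two errors add up to at most 4 (B + M)
   e1, and the extra 1 keeps the denominator positive. *)
pose e1 : R := e / (8 * (B + M + 1)).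
have e10 : 0 < e1 by rewrite divr_gt0// mulr_gt0// ltr_wpDl// addr_ge0.
have [a Fa] : exists a, 1 - F a <= e1.
  move/cvgrPdist_le : Fy => /(_ _ e10) [a [_ aF]].
  exists (a + 1); rewrite (le_trans (ler_norm _))// aF//.
  by rewrite ltrDl.
pose n := `|Num.ceil (a / e1)|%N.
have an : a <= n%:R * e1.
  rewrite -ler_pdivrMr// (le_trans (ceil_ge _))// /n.
  by rewrite natr_absz ler_int ler_norm.
have Fn : 1 - F (n%:R * e1) <= e1 by rewrite (le_trans _ Fa)// lerD2l lerN2 F_nd.
have D := mean_functional_approx F_ge0 F_le1 gM B0 gB e10 Lm LF n.
have D' := mean_functional_approx F_ge0 F_le1 gM B0 gB e10 L'm L'F n.
set S := interpolant_sum _ _ _ _ in D D'.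
rewrite -(subrK S (L g)) -addrA (le_trans (ler_normD _ _))// [X in _ + X]distrC.
rewrite (le_trans (lerD D D'))//.
have e1E : e = 8 * (B + M + 1) * e1.
  by rewrite /e1 mulrC divfK// gt_eqF// mulr_gt0// ltr_wpDl// addr_ge0.
rewrite [leRHS]e1E.
have : M * (1 - F (n%:R * e1)) <= M * e1 by rewrite ler_wpM2l.
have : 0 <= B * e1 by rewrite mulr_ge0// ltW.
have : 0 <= M * e1 by rewrite mulr_ge0// ltW.
nra.
Qed.

(** * Representation by a probability on the line *)

Section BoundedLipschitzIntegral.
Context {R : realType}.
Implicit Types (P Q : probability R R) (g : R -> R).

Lemma bounded_lipschitz_measurable g :
  bounded_lipschitz g -> measurable_fun setT g.
Proof.
move=> [_ [B _ gB]]; apply: continuous_measurable_fun.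
exact: lipschitz_by_continuous gB.
Qed.

Lemma bounded_lipschitz_integrable P g :
  bounded_lipschitz g -> P.-integrable setT (EFin \o g).
Proof.
move=> gbl; apply: measurable_bounded_integrable => //.
- by rewrite -ge0_fin_numE// fin_num_measure.
- exact: bounded_lipschitz_measurable.
- have [[M gM] _] := gbl.
  by exists M; split; [exact: num_real|move=> x Mx y _; exact: le_trans (gM y) (ltW Mx)].
Qed.

Lemma EFin_Rintegral P g : bounded_lipschitz g ->
  ((\int[P]_x g x)%:E = \int[P]_x (g x)%:E)%E.
Proof.
by move=> gbl; rewrite fineK// integrable_fin_num//; exact: bounded_lipschitz_integrable.
Qed.

(** The negative half-line is null and can be removed from the integrals, so a comparison on [0, oo)
    suffices for monotonicity. *)
Lemma Rintegral_mean_functional P :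
  P `]-oo, 0[%classic = 0%E -> mean_functional (fun g => \int[P]_x g x).
Proof.
move=> P0; have I g := @bounded_lipschitz_integrable P g.
split => [c|g h gbl hbl|c g gbl|g h gbl hbl gh].
- rewrite Rintegral_cst// -[RHS]mulr1; congr (_ * _).
  exact: (congr1 fine (probability_setT P)).
- by rewrite RintegralD//; exact: I.
- by rewrite RintegralZl//; exact: I.
- rewrite /Rintegral (negligible_integral _ _ (I _ gbl) P0)//.
  rewrite (negligible_integral _ _ (I _ hbl) P0)//.
  have mD : measurable ([set: R] `\` `]-oo, 0[%classic) by exact: measurableD.
  apply: le_Rintegral => //; [exact: integrableS (I _ gbl)|exact: integrableS (I _ hbl)|].
  by move=> x [_ /negP]; rewrite /= in_itv/= -leNgt; exact: gh.
Qed.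

Lemma Rintegral_ramp P a w : 0 < w ->
  (P `]-oo, a]%classic <= (\int[P]_x ramp a w x)%:E <= P `]-oo, (a + w)%R]%classic)%E.
Proof.
move=> w0; rewrite EFin_Rintegral; last exact: ramp_bl.
have mr : measurable_fun setT (ramp a w) by exact: bounded_lipschitz_measurable (ramp_bl a w0).
have indE b : P `]-oo, b]%classic = (\int[P]_x (\1_(`]-oo, b]%classic : set R) x)%:E)%E.
  by rewrite integral_indic// setIT.
have m1 b : measurable_fun setT (fun x => (\1_(`]-oo, b]%classic : set R) x : R)%:E).
  by apply/measurable_EFinP; exact: measurable_indic.
rewrite !indE; apply/andP; split; apply: ge0_le_integral => //;
  do ?[by move=> x _; rewrite lee_fin ?ramp_ge0]; do ?[exact/measurable_EFinP];
  move=> x _; rewrite lee_fin indicE.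
- have [xa|_] := boolP (x \in _); last by rewrite ramp_ge0.
  by move: xa; rewrite inE/= in_itv/= => /(ramp_eq1 w0)->.
- have [_|] := boolP (x \in _); first by rewrite ramp_le1.
  by move/negP; rewrite inE/= in_itv/= => /negP; rewrite -ltNge => /ltW/(ramp_eq0 w0)->.
Qed.

(** The complements of these rays form a generating class stable under intersection, some of whose
    members exhaust the line. *)
Lemma probability_eq_ray P Q :
  (forall a, P `]-oo, a]%classic = Q `]-oo, a]%classic) ->
  forall A, measurable A -> P A = Q A.
Proof.
move=> PQ; apply: (@measure_unique _ _ _ (@RGenOInfty.G R)
   (fun n => `]- (n%:R : R), +oo[%classic)).
- exact: RGenOInfty.measurableE.
- move=> _ _ [a ->] [b ->]; exists (Num.max a b).
  apply/seteqP; split => x /=; rewrite !in_itv/= !andbT gt_max.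
    by move=> [-> ->].
  by move=> /andP[].
- by move=> n; exists (- n%:R).
- apply/seteqP; split => // x _; exists `|Num.ceil `|x| |%N.+1 => //=.
  rewrite in_itv/= andbT ltrNl (le_lt_trans (ler_norm _))// normrN.
  rewrite (le_lt_trans (ceil_ge _))// -natr1 natr_absz.
  rewrite (le_lt_trans (y := `|Num.ceil `|x| |%:~R))//.
    by rewrite ler_int ler_norm.
  by rewrite ltrDl.
- move=> _ [a ->]; rewrite -setCitvl.
  transitivity (1 - P `]-oo, a]%classic)%E; first exact: probability_setC.
  by rewrite PQ; apply/esym; exact: probability_setC.
- by move=> n; rewrite -ge0_fin_numE// fin_num_measure.
Qed.

Let idR : R -> R := idfun.
#[local] HB.instance Definition _ :=
  @isMeasurableFun.Build _ _ _ _ idR (@measurable_id _ _ setT).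

(** For y > a the ramp falling from a to y bounds the mass of []-oo, a]] under one law by that of
    []-oo, y]] under the other. Let y decrease to a, then exchange the laws. *)
Lemma probability_eq_bounded_lipschitz P Q :
  (forall g, bounded_lipschitz g -> \int[P]_x g x = \int[Q]_x g x) ->
  forall A, measurable A -> P A = Q A.
Proof.
move=> PQ; apply: probability_eq_ray => a.
have le_ray (P1 P2 : probability R R) :
    (forall g, bounded_lipschitz g -> \int[P1]_x g x = \int[P2]_x g x) ->
    (P1 `]-oo, a]%classic <= P2 `]-oo, a]%classic)%E.
  move=> P12; have rc := @cdf_right_continuous _ _ _ P2 (idR : {RV P2 >-> R}) a.
  have {}rc : P2 `]-oo, y]%classic @[y --> a^'+] --> P2 `]-oo, a]%classic by exact: rc.
  rewrite -(cvg_lim _ rc)//; apply: lime_ge; first by apply/cvg_ex; eexists; exact: rc.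
  near=> y; have ay : 0 < y - a by rewrite subr_gt0.
  have /andP[+ _] := Rintegral_ramp P1 a ay; move/le_trans; apply.
  rewrite P12; last exact: ramp_bl.
  by have /andP[_] := Rintegral_ramp P2 a ay; rewrite (_ : a + (y - a) = y)// addrC subrK.
by apply/eqP; rewrite eq_le !le_ray// => g gbl; rewrite PQ.
Unshelve. all: by end_near. Qed.

End BoundedLipschitzIntegral.

(** [L] and the integral against the measure of [mean_cdf L] are sandwiched on ramps by the same
    function, hence agree. *)
Theorem mean_functional_representation (R : realType) (L : (R -> R) -> R) :
  mean_functional L ->
  (forall e : R, 0 < e -> exists2 a, 0 < a & 1 - e <= L (ramp 0 a)) ->
  exists2 P : probability R R, P `]-oo, 0[%classic = 0%E &
    forall g, bounded_lipschitz g -> \int[P]_x g x = L g.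
Proof.
move=> Lm Lt; have [P PF] := mean_cdf_measure Lm Lt.
have P0 : P `]-oo, 0[%classic = 0%E.
  (* The open half-line is a countable union of closed rays with negative endpoints, where
     [mean_cdf L] vanishes. *)
  have : P.-negligible (\bigcup_n (`]-oo, - (n.+1%:R^-1)]%classic : set R)).
    apply: negligible_bigcup => n; apply/negligibleP => //.
    by apply: etrans (PF _) _; rewrite mean_cdf_lt0// oppr_lt0.
  move=> N; apply/negligibleP => //; apply: negligibleS N => x.
  rewrite /= in_itv/= => /ltr_add_invr[n xn]; exists n => //=.
  by rewrite in_itv/= ltW// -subr_lt0 opprK.
exists P => //; apply: (@mean_functional_eq _ (mean_cdf L)) => //.
- exact: mean_cdf_nd.
- exact: mean_cdf_ge0.
- exact: mean_cdf_le1.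
- exact: mean_cdfy.
- exact: Rintegral_mean_functional.
- by move=> a w w0; have := Rintegral_ramp P a w0; rewrite !PF !lee_fin.
- by move=> a w w0; rewrite mean_cdf_le ?mean_cdf_ge.
Qed.

(** * Attaching a Poisson coordinate *)

Section PoissonLift.
Context {R : realType}.
Implicit Types (mu : probability R R) (s : R) (A : set (nat * R)).

(** A negative parameter gives by default the point mass at 0, as the parameter 0 does. *)
Lemma poisson_prob_max s : poisson_prob s 0 = poisson_prob (Num.max s 0) 0.
Proof.
have [//|s0] := leP 0 s.
by apply/funext => U; rewrite /poisson_prob lt_gtF// ltxx.
Qed.

Let poisson_kernel := kprobability (@measurable_poisson_prob R 0).

Lemma measurable_poisson_section A : measurable A ->
  measurable_fun setT (fun s => poisson_prob s 0 [set k | A (k, s)]).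
Proof.
(* The coordinates are swapped because the kernel goes from intensities to counts and sections fix
   the first coordinate. *)
move=> mA; pose A' : set (R * nat) := [set x | A (x.2, x.1)].
have mA' : measurable A'.
  rewrite -[A']setTI.
  have m : measurable_fun setT (fun x : R * nat => (x.2, x.1)).
    exact: measurable_fun_pair.
  exact: m measurableT _ mA.
have := @measurable_fun_xsection_finite_kernel _ _ _ _ _ poisson_kernel A' (mem_set mA').
rewrite (_ : (fun s => _) = (fun s => poisson_prob s 0 [set k | A (k, s)]))//.
apply/funext => s; congr poisson_prob.
by apply/seteqP; split => k /=; rewrite xsectionE.
Qed.

Let pair_with s (k : nat) : nat * R := (k, s).

Let measurable_pair_with s : measurable_fun setT (pair_with s).
Proof. by []. Qed.

Let pair_law s : giry (nat * R)%type R :=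
  giry_map (measurable_pair_with s) (poisson_prob s 0).

Let measurable_pair_law : measurable_fun setT pair_law.
Proof.
apply: measurable_giry_codensity => // A mA.
exact: measurable_poisson_section.
Qed.

(** The mixture over [mu] of the laws [pair_law s], that is, their bind in the Giry monad. *)
Lemma poisson_lift_exists mu : exists P : probability (nat * R)%type R,
  forall h, measurable_fun setT h -> (forall x, 0 <= h x)%E ->
    (\int[P]_x h x = \int[mu]_s \int[poisson_prob s 0]_k h (k, s))%E.
Proof.
pose m : giry _ R := giry_bind mu measurable_pair_law.
have mE h : measurable_fun setT h -> (forall x, 0 <= h x)%E ->
    (\int[m]_x h x = \int[mu]_s \int[poisson_prob s 0]_k h (k, s))%E.
  move=> mh h0.
  rewrite -[LHS]/(giry_int m h) giry_int_bind//; apply: eq_integral => s _.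
  exact: giry_int_map.
have m1 : m setT = 1%E.
  rewrite -(setIT setT) -integral_indic// mE//.
    rewrite (eq_integral (cst 1%E)).
      by rewrite integral_cst// mul1e; exact: probability_setT.
    move=> s _; rewrite (eq_integral (cst 1%E)).
      by rewrite integral_cst// mul1e; exact: probability_setT.
    by move=> k _; rewrite indicT.
  by apply/measurable_EFinP; exact: measurable_indic.
(* The bind comes as a subprobability; total mass 1 promotes it. *)
pose P : probability (nat * R)%type R :=
  HB.pack (m : set _ -> \bar R) (SubProbability.class m)
    (Measure_isProbability.Build _ _ _ m m1).
by exists P.
Qed.

End PoissonLift.

(** * Stationary laws *)

Lemma measurable_fun_nat_prod (R : realType) (F : nat * R -> R) :
  (forall k, measurable_fun setT (fun s => F (k, s))) -> measurable_fun setT F.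
Proof.
move=> mF _ Y mY; rewrite setTI.
rewrite (_ : F @^-1` Y =
    \bigcup_k ([set k] `*` ((fun s => F (k, s)) @^-1` Y))); last first.
  apply/seteqP; split => [[k s] /= Fks|[k s] [j _ /= [-> ]]//].
  by exists k.
apply: bigcupT_measurable => k; apply: measurableX => //.
by rewrite -[_ @^-1` _]setTI; exact: mF.
Qed.

Lemma ge0_integral_full d (T : measurableType d) (R : realType)
    (P : probability T R) (D : set T) (h : T -> \bar R) :
  measurable D -> P D = 1%E -> measurable_fun setT h -> (forall x, 0 <= h x)%E ->
  (\int[P]_(x in D) h x = \int[P]_x h x)%E.
Proof.
move=> mD PD mh h0; have mC : measurable (~` D) by exact: measurableC.
have PC : P (~` D) = 0%E by rewrite probability_setC// PD subee.
rewrite -(setUv D) ge0_integral_setU//; last 2 first.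
- by rewrite setUv.
- by apply/disj_set2P; rewrite setICr.
by rewrite [X in (_ + X)%E](null_set_integral _ _ PC) ?adde0//;
  exact: measurable_funTS.
Qed.

Section StationaryLaw.
Context {R : realType}.
Variables (f : R -> nat -> R) (k1 k2 : R).
Hypotheses (f_ge0 : forall l y, 0 <= l -> 0 <= f l y)
  (k1_ge0 : 0 <= k1) (k2_ge0 : 0 <= k2) (k12_lt1 : k1 + k2 < 1)
  (f_contr : forall l l' (y y' : nat), 0 <= l -> 0 <= l' ->
      `|f l y - f l' y'| <= k1 * `|l - l'| + k2 * `|y%:R - y'%:R|).
Implicit Types (P Q : probability (nat * R)%type R) (mu nu : probability R R).

Local Notation phi := (next_intensity f).
Local Notation K := (transition_op f).
Local Notation L := (stationary_mean f).

Lemma measurable_next_intensity : measurable_fun setT phi.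
Proof.
apply: measurable_fun_nat_prod => k.
apply: continuous_measurable_fun.
apply: (@lipschitz_by_continuous _ k1) => s t; rewrite /next_intensity/=.
rewrite (le_trans (f_contr _ _ _ _)) ?le_max ?lexx ?orbT//.
rewrite subrr normr0 mulr0 addr0 ler_wpM2l//.
have st := ler_norm (s - t); have ts := ler_norm (t - s).
rewrite distrC in ts; rewrite ler_norml.
by case: (leP s 0) => s0; case: (leP t 0) => t0; lra.
Qed.

(** Like [is_intensity_law], a specification by integrals rather than a construction, so that a
    fixed law can be shown to satisfy both at once. *)
Definition is_poisson_lift mu P := forall h, measurable_fun setT h ->
  (forall x, 0 <= h x)%E ->
  (\int[P]_x h x = \int[mu]_s \int[poisson_prob s 0]_k h (k, s))%E.

Definition is_intensity_law P nu := forall h : R -> \bar R,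
  measurable_fun setT h -> (forall s, 0 <= h s)%E ->
  (\int[nu]_s h s = \int[P]_x h (phi x))%E.

Lemma intensity_law_exists P : exists nu, is_intensity_law P nu.
Proof.
pose X : {mfun (nat * R)%type >-> R} :=
  HB.pack phi (isMeasurableFun.Build _ _ _ _ phi measurable_next_intensity).
exists (distribution P X) => h mh h0.
by rewrite /distribution ge0_integral_pushforward.
Qed.

Lemma is_poisson_lift_set mu P A : is_poisson_lift mu P -> measurable A ->
  P A = (\int[mu]_s poisson_prob s 0 [set k | A (k, s)])%E.
Proof.
move=> muP mA; rewrite -[in LHS](setIT A) -integral_indic// muP//; last first.
  by apply/measurable_EFinP; exact: measurable_indic.
by apply: eq_integral => s _; rewrite -[in RHS](setIT [set k | _]) -integral_indic.
Qed.

Lemma trans_kernelE x A : @state_space R x ->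
  trans_kernel f x A = poisson_prob (phi x) 0 [set k | A (k, phi x)].
Proof.
by move=> x0; rewrite /trans_kernel /next_intensity max_l.
Qed.

Lemma measurable_state_space : measurable (@state_space R).
Proof.
rewrite [X in measurable X](_ : _ = setT `&` snd @^-1` `[0, +oo[%classic).
  exact: measurable_snd.
by apply/seteqP; split => x /=; rewrite in_itv/= andbT// => -[].
Qed.

(** A step of the chain first passes to the next intensity and then draws a Poisson count with that
    parameter. *)
Lemma integral_trans_kernel P nu A : P (@state_space R) = 1%E ->
  is_intensity_law P nu -> measurable A ->
  (\int[P]_(x in @state_space R) trans_kernel f x A =
   \int[nu]_s poisson_prob s 0 [set k | A (k, s)])%E.
Proof.
move=> P1 Pnu mA.
rewrite Pnu//; last exact: measurable_poisson_section.
have mJ : measurable_fun setT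
    (fun x => poisson_prob (phi x) 0 [set k | A (k, phi x)]).
  exact: (measurableT_comp (measurable_poisson_section mA) measurable_next_intensity).
rewrite -(ge0_integral_full measurable_state_space P1 mJ)//.
by apply: eq_integral => x; rewrite inE => x0; rewrite trans_kernelE.
Qed.

Lemma stationary_is_poisson_lift P nu : is_intensity_law P nu ->
  stationary f P -> is_poisson_lift nu P.
Proof.
move=> Pnu [P1 PE]; have [Q nuQ] := poisson_lift_exists nu.
have PQ A : measurable A -> P A = Q A.
  by move=> mA; rewrite PE// (integral_trans_kernel P1 Pnu)// (is_poisson_lift_set nuQ).
move=> h mh h0; rewrite -nuQ//; apply: eq_measure_integral => A mA _; exact: PQ.
Qed.

Lemma is_poisson_lift_stationary P nu : nu `]-oo, 0[%classic = 0%E ->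
  is_intensity_law P nu -> is_poisson_lift nu P -> stationary f P.
Proof.
move=> nu0 Pnu nuP.
have P1 : P (@state_space R) = 1%E.
  have := probability_setC P measurable_state_space.
  rewrite (is_poisson_lift_set nuP); last by apply: measurableC; exact: measurable_state_space.
  (* Given the intensity s, the complement of the state space has probability 1 or 0 according as s
     is negative or not, so its mass is that of the negative half-line under [nu]. *)
  rewrite (eq_integral (fun s : R => (\1_(`]-oo, 0[%classic : set R) s)%:E)).
    rewrite (_ : integral _ _ _ = 0%E); last first.
      by rewrite integral_indic// setIT; exact: nu0.
    move=> /esym/eqP; rewrite sube_eq ?fin_num_adde_defl ?fin_num_measure//;
      last exact: measurable_state_space.
    by rewrite add0e => /eqP.
  move=> s _; rewrite indicE; have [s0|s0] := boolP (s \in _).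
    rewrite (_ : [set k | _] = setT); first exact: probability_setT.
    apply/seteqP; split => // k _ /=; move: s0; rewrite inE/= in_itv/=.
    by rewrite ltNge => /negP.
  rewrite (_ : [set k | _] = set0) ?measure0//.
  apply/seteqP; split => // k /=; move: s0; rewrite notin_setE/= in_itv/=.
  by move=> /negP; rewrite -leNgt.
split=> // A mA.
by rewrite (integral_trans_kernel P1 Pnu)// (is_poisson_lift_set nuP).
Qed.

Lemma next_law_ge0 mu P nu M g : is_poisson_lift mu P -> is_intensity_law P nu ->
  bounded_lipschitz g -> bounded_by M g -> (forall s, 0 <= g s) ->
  \int[nu]_s g s = \int[mu]_s K g s.
Proof.
move=> muP Pnu gbl gM g0; have mg := bounded_lipschitz_measurable gbl.
rewrite /Rintegral; congr fine; rewrite Pnu//; last exact/measurable_EFinP.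
rewrite (muP (fun x => (g (phi x))%:E)).
- apply: eq_integral => s _; rewrite poisson_prob_max.
  by rewrite (@integral_poisson _ _ M)// le_max lexx orbT.
- apply/measurable_EFinP; apply: measurableT_comp => //.
  exact: measurable_next_intensity.
- by move=> x; rewrite lee_fin.
Qed.

(** Adding the bound [M] makes [g] nonnegative, and both sides carry constants through unchanged. *)
Lemma next_law_mean mu P nu g : is_poisson_lift mu P -> is_intensity_law P nu ->
  bounded_lipschitz g -> \int[nu]_s g s = \int[mu]_s K g s.
Proof.
move=> muP Pnu gbl; have [[M gM] _] := gbl.
have I (N : probability R R) g' := @bounded_lipschitz_integrable _ N g'.
have cbl := @bounded_lipschitz_cst R M.
have Kgbl := transition_op_bl k1_ge0 k2_ge0 f_contr gbl.
have gMbl := bounded_lipschitzD gbl cbl.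
have RE (N : probability R R) g' : bounded_lipschitz g' ->
    \int[N]_s (g' s + M) = \int[N]_s g' s + M.
  move=> g'bl; rewrite RintegralD//; [|exact: I|exact: I].
  congr (_ + _); rewrite Rintegral_cst// -[RHS]mulr1; congr (_ * _).
  exact: (congr1 fine (probability_setT N)).
apply: (addIr M); rewrite -!RE//.
rewrite (@next_law_ge0 mu P nu (M + `|M|))//.
- apply: eq_Rintegral => s _; rewrite /transition_op.
  rewrite (@poisson_meanD _ _ (cst M) M `|M|) ?poisson_mean_cst//.
- by move=> s; rewrite (le_trans (ler_normD _ _))// lerD.
- by move=> s; have := gM s; rewrite ler_norml addrC -lerBlDl sub0r => /andP[].
Qed.

(** By invariance [nu] gives all iterates of [g] the same integral, while they converge boundedly to
    the constant [L g]: dominated convergence concludes. *)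
Lemma stationary_intensity_mean P nu g : is_intensity_law P nu ->
  is_poisson_lift nu P -> bounded_lipschitz g -> \int[nu]_s g s = L g.
Proof.
move=> Pnu nuP gbl.
have Kbl n := iter_transition_op_bl k1_ge0 k2_ge0 f_contr n gbl.
have KE n : \int[nu]_s iter n K g s = \int[nu]_s g s.
  by elim: n => //= n <-; rewrite -(next_law_mean nuP Pnu).
have [[M gM] _] := gbl.
have : (\int[nu]_s (iter n K g s)%:E)%E @[n --> \oo] --> (\int[nu]_s (L g)%:E)%E.
  apply: (@dominated_cvg _ _ _ _ _ _ _ _ (cst M%:E)) => //.
  - by move=> n; apply/measurable_EFinP; exact: bounded_lipschitz_measurable.
  - move=> s _; apply: cvg_EFin; first by near=> n.
    exact: (cvg_iter_transition_op f_ge0 k1_ge0 k2_ge0 k12_lt1 f_contr).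
  - exact: (bounded_lipschitz_integrable nu (bounded_lipschitz_cst M)).
  - by move=> n s _; rewrite lee_fin; exact: iter_transition_op_bounded.
under eq_fun do rewrite -EFin_Rintegral// KE.
rewrite integral_cst// => cL.
have : (\int[nu]_s g s)%:E = ((L g)%:E * nu setT)%E.
  by apply: (cvg_unique _ _ cL) => //; exact: cvg_cst.
rewrite (_ : nu setT = 1%E); last exact: probability_setT.
by rewrite mule1 => -[].
Unshelve. all: by end_near. Qed.

Lemma stationary_mean_tight e : 0 < e ->
  exists2 a, 0 < a & 1 - e <= L (ramp 0 a).
Proof.
move=> e0; pose C := f 0 0%N / (1 - (k1 + k2)).
have C0 : 0 <= C by rewrite divr_ge0 ?f_ge0// subr_ge0 ltW.
have a0 : 0 < C / e + 1 by rewrite ltr_wpDl// divr_ge0// ltW.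
(* [ramp 0 a] is 1 at 0 with Lipschitz constant 1 / a, so its mean is at least 1 - C / a. The added
   1 keeps a positive when C = 0. *)
exists (C / e + 1) => //.
have ia0 : 0 <= (C / e + 1)^-1 by rewrite invr_ge0 ltW.
have := stationary_mean_dist0 f_ge0 k1_ge0 k2_ge0 k12_lt1 f_contr ia0
  (ramp_bl 0 a0) (ramp_lipschitz 0 a0).
rewrite (ramp_eq1 a0)// distrC => /(le_trans (ler_norm _)) Le.
have Ca : (C / e + 1)^-1 * f 0 0%N / (1 - (k1 + k2)) <= e.
  rewrite -mulrA -/C mulrC ler_pdivrMr// mulrDr mulrCA divff ?gt_eqF// mulr1.
  by rewrite mulr1 lerDl ltW.
lra.
Qed.

(** Let [mu] represent [L] and let [P] be its lift. The next intensity under [P] integrates [g] to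
    [L (K g)], which is [L g], so it has law [mu] again. *)
Lemma stationary_law_exists : exists mu P,
  [/\ mu `]-oo, 0[%classic = 0%E, is_intensity_law P mu, is_poisson_lift mu P
    & forall g, bounded_lipschitz g -> \int[mu]_s g s = L g].
Proof.
have Lm := stationary_mean_functional f_ge0 k1_ge0 k2_ge0 k12_lt1 f_contr.
have [mu mu0 muL] := mean_functional_representation Lm stationary_mean_tight.
have [P muP] := poisson_lift_exists mu.
have [nu Pnu] := intensity_law_exists P.
have numu A : measurable A -> nu A = mu A.
  apply: probability_eq_bounded_lipschitz => g gbl.
  rewrite (next_law_mean muP Pnu)// !muL//;
    last exact: (transition_op_bl k1_ge0 k2_ge0 f_contr gbl).
  exact: (stationary_mean_op f_ge0 k1_ge0 k2_ge0 k12_lt1 f_contr).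
exists mu, P; split => // h mh h0; rewrite -Pnu//.
by apply: eq_measure_integral => A mA _; apply/esym; exact: numu.
Qed.

(** Both laws are lifts of their intensity laws, and these integrate every test function to the same
    value of [L]. *)
Lemma stationary_unique P P' : stationary f P -> stationary f P' ->
  forall A, measurable A -> P' A = P A.
Proof.
move=> sP sP' A mA.
have [nu Pnu] := intensity_law_exists P.
have [nu' Pnu'] := intensity_law_exists P'.
have nuP := stationary_is_poisson_lift Pnu sP.
have nuP' := stationary_is_poisson_lift Pnu' sP'.
rewrite (is_poisson_lift_set nuP mA) (is_poisson_lift_set nuP' mA).
apply: eq_measure_integral => B mB _.
apply: probability_eq_bounded_lipschitz => // g gbl.
by rewrite (stationary_intensity_mean Pnu')// (stationary_intensity_mean Pnu).
Qed.

Lemma stationary_mean_finite mu P : is_poisson_lift mu P ->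
  (forall g, bounded_lipschitz g -> \int[mu]_s g s = L g) ->
  P (@state_space R) = 1%E ->
  (\int[P]_(x in @state_space R) (x.2)%:E < +oo)%E.
Proof.
move=> muP muL P1.
have mmax : measurable_fun setT (fun s : R => Num.max s 0).
  exact: measurable_maxr.
have mh : measurable_fun setT (fun x : nat * R => (Num.max x.2 0)%:E).
  by apply/measurable_EFinP; apply: measurableT_comp mmax _; exact: measurable_snd.
have h0 (x : nat * R) : (0 <= (Num.max x.2 0)%:E)%E.
  by rewrite lee_fin le_max lexx orbT.
rewrite (eq_integral (fun x : nat * R => (Num.max x.2 0)%:E)); last first.
  by move=> x; rewrite inE => x0; rewrite max_l.
rewrite (ge0_integral_full measurable_state_space P1 mh h0) muP//.
rewrite (eq_integral (fun s : R => (Num.max s 0)%:E)); last first.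
  move=> s _; rewrite (eq_integral (cst (Num.max s 0)%:E))//.
  rewrite integral_cst// -[RHS]mule1; congr (_ * _)%E; exact: probability_setT.
(* These truncations are 1-Lipschitz and vanish at 0, so their means share the bound f(0,0) / (1 -
   k1 - k2); monotone convergence passes it to the limit. *)
pose g n (s : R) := Num.min (Num.max s 0) n%:R.
have g_ge0 n s : 0 <= g n s by rewrite /g le_min ler0n le_max lexx orbT.
have gB n : lipschitz_by 1 (g n).
  move=> s t; rewrite mul1r /g.
  have st := ler_norm (s - t); have ts := ler_norm (t - s).
  rewrite distrC in ts; rewrite ler_norml; have n0 : 0 <= n%:R :> R by [].
  by case: (leP s 0) => s0; case: (leP t 0) => t0;
    do ?[case: (leP 0 n%:R) => n1]; do ?[case: (leP s n%:R) => sn];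
    do ?[case: (leP t n%:R) => tn]; lra.
have gbl n : bounded_lipschitz (g n).
  split; last by exists 1.
  by exists n%:R => s; rewrite ger0_norm// ge_min lexx orbT.
have gE n : (\int[mu]_s (g n s)%:E <= (f 0 0%N / (1 - (k1 + k2)))%:E)%E.
  rewrite -EFin_Rintegral// muL// lee_fin.
  have := stationary_mean_dist0 f_ge0 k1_ge0 k2_ge0 k12_lt1 f_contr ler01 (gbl n) (gB n).
  by rewrite mul1r {2}/g maxxx min_l// subr0 => /(le_trans (ler_norm _)).
rewrite (eq_integral (fun s : R => limn (fun n => (g n s)%:E))); last first.
  move=> s _; apply/esym/cvg_lim => //; apply: cvg_near_cst; near=> n.
  rewrite /g min_l//; near: n.
  exact: nbhs_infty_ger.
rewrite monotone_convergence//; last 3 first.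
- by move=> n; apply/measurable_EFinP; exact: bounded_lipschitz_measurable.
- by move=> n s _; rewrite lee_fin.
- move=> s _ m n mn; rewrite lee_fin /g le_min ge_min lexx ge_min ler_nat mn orbT//.
apply: (@le_lt_trans _ _ (f 0 0%N / (1 - (k1 + k2)))%:E); last exact: ltry.
apply: lime_le; last by near=> n; exact: gE.
apply: ereal_nondecreasing_is_cvgn => m n mn; apply: ge0_le_integral => //.
- by move=> s _; rewrite lee_fin.
- by apply/measurable_EFinP; exact: bounded_lipschitz_measurable.
- by apply/measurable_EFinP; exact: bounded_lipschitz_measurable.
- by move=> s _; rewrite lee_fin /g le_min ge_min lexx ge_min ler_nat mn orbT.
Unshelve. all: by end_near. Qed.


End StationaryLaw.

(** * Degenerate and non-degenerate stationary laws *)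

Lemma poisson_prob_set1_lt1 (R : realType) (s : R) k :
  0 < s -> (poisson_prob s 0 [set k] < 1)%E.
Proof.
(* The neighbouring singleton takes a positive share of the total mass. *)
move=> s0; have P1 : (poisson_prob s 0 [set k] + poisson_prob s 0 [set k.+1] <= 1)%E.
  rewrite -measureU//; last first.
    by apply/seteqP; split => // j [/= -> ] /eqP; rewrite eqn_leq ltnn andbF.
  exact: probability_le1.
apply: lt_le_trans P1; rewrite !poisson_prob_set1 ?(ltW s0)// -EFinD lte_fin.
by rewrite ltrDl mulr_gt0 ?expR_gt0// divr_gt0 ?exprn_gt0// ltr0n fact_gt0.
Qed.

Theorem theorem2p1 (R : realType) (f : R -> nat -> R) :
  contractive f ->
  exists P : probability (nat * R)%type R,
    [/\ stationary f P,
        (forall P' : probability (nat * R)%type R, stationary f P' ->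
           forall A, measurable A -> P' A = P A),
        (\int[P]_(x in @state_space R) (x.2)%:E < +oo)%E,
        (f 0 0%N = 0 ->
           forall A, measurable A -> P A = \d_(0%N, 0 : R) A) &
        (0 < f 0 0%N ->
           forall (y : nat) (l : R), (P [set (y, l)] < 1)%E)].
Proof.
move=> [f_ge0 [k1 [k2 [k1_ge0 k2_ge0 k12 f_contr]]]].
have [mu [P [mu0 Pmu muP muL]]] :=
  stationary_law_exists f_ge0 k1_ge0 k2_ge0 k12 f_contr.
have sP := is_poisson_lift_stationary k1_ge0 f_contr mu0 Pmu muP.
have unique P' : stationary f P' -> forall A, measurable A -> P' A = P A.
  exact: (stationary_unique f_ge0 k1_ge0 k2_ge0 k12 f_contr).
exists P; split => //.
- exact: (stationary_mean_finite f_ge0 k1_ge0 k2_ge0 k12 f_contr muP muL sP.1).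
- move=> f00 A mA.
  (* With f(0,0) = 0 the bound on the distance from [L g] to [g 0] is zero. *)
  have mu_dirac B : measurable B -> mu B = \d_(0 : R) B.
    apply: probability_eq_bounded_lipschitz => g gbl; have [_ [B' B'0 gB]] := gbl.
    have mg := bounded_lipschitz_measurable gbl.
    rewrite muL// /Rintegral integral_dirac//; last exact/measurable_EFinP.
    rewrite diracT mul1e; apply/eqP; rewrite -subr_eq0 -normr_le0.
    have := stationary_mean_dist0 f_ge0 k1_ge0 k2_ge0 k12 f_contr B'0 gbl gB.
    by rewrite f00 mulr0 mul0r.
  rewrite (is_poisson_lift_set muP mA) (eq_measure_integral (\d_(0 : R))); last first.
    by move=> B mB _; exact: mu_dirac.
  rewrite integral_dirac//; last exact: measurable_poisson_section.
  by rewrite diracT mul1e /poisson_prob ltxx !diracE; congr ((nat_of_bool _)%:R%:E);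
     apply/idP/idP; rewrite !inE.
move=> f00 y l; rewrite ltNge; apply/negP => P1.
set x := (y, l); have mx : measurable [set x].
  rewrite (_ : [set x] = [set y] `*` [set l]); first exact: measurableX.
  by apply/seteqP; split => [_ ->//|[a b] /= [-> ->]].
have {}P1 : P [set x] = 1%E.
  by apply/eqP; rewrite eq_le P1 andbT; exact: probability_le1.
have mJ := measurable_poisson_section mx.
(* If all mass sits at [x], stationarity makes the chain return from [x] to [x] with probability
   1. *)
have E : poisson_prob (next_intensity f x) 0
    [set k | [set x] (k, next_intensity f x)] = 1%E.
  rewrite -[RHS]P1 (is_poisson_lift_set muP mx) Pmu//.
  have mJphi := measurableT_comp mJ (measurable_next_intensity k1_ge0 f_contr).
  rewrite -(ge0_integral_full mx P1 mJphi)//.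
  rewrite [RHS](eq_integral (cst (poisson_prob (next_intensity f x) 0
    [set k | [set x] (k, next_intensity f x)]))); last first.
    by move=> z; rewrite inE => ->.
  by rewrite integral_cst// -[LHS]mule1; congr (_ * _)%E; rewrite -P1.
(* The next intensity is deterministic, so any other value would make the return impossible. *)
have phi_l : next_intensity f x = l.
  apply: contrapT => nl; move: E; rewrite (_ : [set k | _] = set0).
    by rewrite measure0 => /esym/eqP; rewrite onee_eq0.
  by apply/seteqP; split => // k [].
have l_ge0 : 0 <= l by rewrite -phi_l; exact: next_intensity_ge0.
move: E; rewrite phi_l (_ : [set k | _] = [set y]); last first.
  by apply/seteqP; split => k /= => [[]|->].
(* A positive [l] is excluded because no singleton has full Poisson mass. *)
move: l_ge0; rewrite le_eqVlt => /predU1P[l0|l_gt0]; last first.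
  by move=> E; have := poisson_prob_set1_lt1 y l_gt0; rewrite E ltxx.
rewrite -l0 /poisson_prob ltxx diracE.
(* With [l] = 0 the count is 0, so [x] is (0, 0) and its next intensity f(0,0) equals 0, against the
   assumption. *)
case: y @x mx P1 mJ phi_l => [|y] x mx P1 mJ phi_l; last first.
  by rewrite memNset// => /eqP; rewrite eq_sym onee_eq0.
move: phi_l f00; rewrite /next_intensity/= -l0 maxxx => ->.
by rewrite ltxx.
Qed.
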